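(* Let $n>1$ and let $Y_1,\dots,Y_{n+1}$ follow the straight line regression model $Y_i=\beta_1+\beta_2h_i+\varepsilon_i$ with $E(\varepsilon_i)=0$. Suppose the random variables $Y_i$, $i=1,\dots,n+1$, are uncorrelated with non-increasing variances $\sigma_1^2\ge\sigma_2^2\ge\dots\ge\sigma_{n+1}^2$, and the values of the explanatory variable are non-negative and increasing: $0\le h_1<h_2<\dots<h_{n+1}$. Then the ordinary least squares estimators of the intercept $\beta_1$ and the slope $\beta_2$ have the variance reduction property: $$V_{11}(i,i)\le V_{00}(i,i)\qquad\text{for } i\in\{1,2\}.$$
   Context: $A_1$ is the $(n+1)\times2$ design matrix whose $i$-th row is $(1,h_i)$, and $A_0$ is the $n\times 2$ matrix consisting of its first $n$ rows. $A_{00}=A_0^TA_0$, $A_{11}=A_1^TA_1$, $\mathbf{\Sigma}_{11}=\mathrm{Diag}\{\sigma_1^2,\dots,\sigma_{n+1}^2\}$, $\mathbf{\Sigma}_{00}=\mathrm{Diag}\{\sigma_1^2,\dots,\sigma_n^2\}$. The ordinary least squares (OLS) estimators of $\beta=(\beta_1,\beta_2)^T$ based on the first $n$ and on all $n+1$ observations are $\hat\beta_0=A_{00}^{-1}A_0^T(Y_1,\dots,Y_n)^T$ and $\hat\beta_1=A_{11}^{-1}A_1^T(Y_1,\dots,Y_{n+1})^T$; their covariance matrices are $$V_{00}=A_{00}^{-1}A_0^T\mathbf{\Sigma}_{00}A_0A_{00}^{-1},\qquad V_{11}=A_{11}^{-1}A_1^T\mathbf{\Sigma}_{11}A_1A_{11}^{-1}.$$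 *)

(* Defs.v *)
From HB Require Import structures.
From mathcomp Require Import all_boot all_order all_algebra.
From mathcomp Require Import all_classical all_reals all_analysis.

Set Implicit Arguments.
Unset Strict Implicit.
Unset Printing Implicit Defensive.

Import Order.TTheory GRing.Theory Num.Theory.

Local Open Scope ring_scope.

Definition design (R : realType) (m : nat) (h : 'I_m -> R) : 'M[R]_(m, 2) :=
  \matrix_(i, j) (if j == 0 then 1 else h i).

(* Observations are indexed by 'I_n.+1; composing with [first_obs] selects the
   first n of them. *)
Definition first_obs (n : nat) : 'I_n -> 'I_n.+1 := widen_ord (leqnSn n).

Definition ols (R : realType) (m : nat) (A : 'M[R]_(m, 2)) (y : 'cV[R]_m) :
    'cV[R]_2 :=
  invmx (A^T *m A) *m A^T *m y.

(* [s i] is the standard deviation of the i-th observation. *)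
Definition Sigma (R : realType) (m : nat) (s : 'I_m -> R) : 'M[R]_m :=
  diag_mx (\row_i s i ^+ 2).

Definition ols_cov (R : realType) (m : nat) (A : 'M[R]_(m, 2)) (S : 'M[R]_m) :
    'M[R]_2 :=
  invmx (A^T *m A) *m A^T *m S *m A *m invmx (A^T *m A).

Section RegressionModel.
Context (R : realType) (n : nat) (h sigma : 'I_n.+1 -> R).

Definition A1 : 'M[R]_(n.+1, 2) := design h.
Definition A0 : 'M[R]_(n, 2) := rowsub (@first_obs n) A1.

Definition V11 : 'M[R]_2 := ols_cov A1 (Sigma sigma).
Definition V00 : 'M[R]_2 := ols_cov A0 (Sigma (sigma \o @first_obs n)).

Definition beta_hat1 (T : Type) (Y : 'I_n.+1 -> T -> R) (t : T) : 'cV[R]_2 :=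
  ols A1 (\col_i Y i t).
Definition beta_hat0 (T : Type) (Y : 'I_n.+1 -> T -> R) (t : T) : 'cV[R]_2 :=
  ols A0 (\col_i Y (first_obs i) t).

End RegressionModel.

Definition is_cov_matrix d (T : measurableType d) (R : realType)
    (P : probability T R) (m : nat) (Z : T -> 'cV[R]_m) (V : 'M[R]_m) : Prop :=
  forall i j : 'I_m,
    covariance P (fun t => Z t i 0) (fun t => Z t j 0) = (V i j)%:E.

(* Main.v *)
Require Import Defs.
From HB Require Import structures.
From mathcomp Require Import all_boot all_order all_algebra.
From mathcomp Require Import all_classical all_reals all_analysis.
From mathcomp Require Import ring.

Import Order.TTheory GRing.Theory Num.Theory.

Local Open Scope ring_scope.

(** An OLS estimator of [p * beta1 + q * beta2] is the linear combination of
    the observations whose coefficient at the point [y] is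
    [w y = (p, q) (A^T A)^-1 (1, y)^T], an affine function of [y]; as the
    observations are uncorrelated, its variance is the sum of the
    [w (h i) ^+ 2 * sigma i ^+ 2]. Everything then rests on comparing the
    coefficients [w0], [w1] of the two estimators.

    Let [M] be the new point, let [l y = (1, M) (A0^T A0)^-1 (1, y)^T] be the
    coefficients with which the old data predict the value at [M], and put
    [L = l M > 0], [k = 1 / (1 + L)]. The recursive least squares (rank one
    update) formula reads [w1 y = w0 y - k * w0 M * l y] ([weight_update]).
    Moreover [w0] is, like every affine function, a combination of [l y] and
    [M - y]: the coefficients are found in [weight_leverage]. Substituting,
      [L * (w0 y ^+ 2 - w1 y ^+ 2) =
         k * (1 + k) * w0 M ^+ 2 * l y ^+ 2 - c * (l y * (M - y))],
    where [c] is a positive multiple of [(q - p * M) * w0 M].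

    Now sum over the old points with the variances as weights. The weights [l]
    predict affine functions exactly, so that the sum of the [l y * (M - y)] is
    the value at [M] of the function [M - y], namely 0. As [l] is increasing,
    the negative terms of this sum come first, and non-increasing variances
    give them more weight than the positive ones: the weighted sum is at most 0
    ([sum_crossing_le0]). If [c >= 0], what remains is the sum of squares; its
    weighted sum is at least the last variance times [L], the sum of the
    [l y ^+ 2], which more than pays for the term
    [(w1 M) ^+ 2 = (k * w0 M) ^+ 2] of the new observation
    ([weight_variance_le]).

    It remains to see that [(q - p * M) * w0 M >= 0]. For the slope this says
    that [M] is at least the mean of the old points, and for the intercept it
    follows from [0 <= h i <= M]; this is where the signs of the points
    matter. *)

(** * Covariance of linear combinations *)

Section Covariance.
Context {d : measure_display} {T : measurableType d} {R : realType}.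
Variable P : probability T R.

Lemma lincomb_cons (I : Type) (i : I) (s : seq I) (c : I -> R)
    (X : I -> T -> R) :
  (fun t => \sum_(j <- i :: s) c j * X j t) =
  (c i \o* X i) \+ (fun t => \sum_(j <- s) c j * X j t).
Proof. by apply/funext => t; rewrite big_cons mulrC. Qed.

Lemma Lfun2_lincomb (I : Type) (s : seq I) (c : I -> R) (X : I -> T -> R) :
  (forall i, X i \in Lfun P 2%:E) ->
  (fun t => \sum_(i <- s) c i * X i t) \in Lfun P 2%:E.
Proof.
move=> X2; have lee12 : (1 <= 2%:E :> \bar R)%E by rewrite lee1n.
elim: s => [|i s IHs].
  under eq_fun do rewrite big_nil.
  exact: Lfun_cst.
rewrite lincomb_cons.
by apply: (Lfun_addr_closed P lee12).2 => //; rewrite Lfun_scale// ler1n.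
Qed.

Lemma covariance_lincombl (I : Type) (s : seq I) (c : I -> R)
    (X : I -> T -> R) (Z : T -> R) :
  (forall i, X i \in Lfun P 2%:E) -> Z \in Lfun P 2%:E ->
  (covariance P (fun t => \sum_(i <- s) c i * X i t)%R Z =
   \sum_(i <- s) (c i)%:E * covariance P (X i) Z)%E.
Proof.
move=> X2 Z2; elim: s => [|i s IHs].
  under eq_fun do rewrite big_nil.
  by rewrite big_nil covariance_cst_l.
rewrite lincomb_cons big_cons -IHs.
have Pfin : P setT \is a fin_num := fin_num_measure P _ measurableT.
rewrite covarianceDl ?Lfun2_lincomb ?Lfun_scale ?ler1n//.
by rewrite covarianceZl ?Lfun2_mul_Lfun1 ?(Lfun_subset12 Pfin).
Qed.

Lemma covariance_lincombr (I : Type) (s : seq I) (c : I -> R)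
    (X : I -> T -> R) (Z : T -> R) :
  (forall i, X i \in Lfun P 2%:E) -> Z \in Lfun P 2%:E ->
  (covariance P Z (fun t => \sum_(i <- s) c i * X i t)%R =
   \sum_(i <- s) (c i)%:E * covariance P Z (X i))%E.
Proof.
move=> X2 Z2; rewrite covarianceC covariance_lincombl//.
by apply: eq_bigr => i _; rewrite covarianceC.
Qed.

(** Both estimators of the theorem are linear in the observations, with matrix
    [W = (A^T A)^-1 A^T]; covariance is bilinear on square integrable variables,
    and only its diagonal terms survive for uncorrelated ones. *)
Lemma is_cov_matrix_linear (m k : nat) (X : 'I_m -> T -> R) (s : 'I_m -> R)
    (W : 'M[R]_(k, m)) :
  (forall i, X i \in Lfun P 2%:E) ->
  (forall i j, i != j -> covariance P (X i) (X j) = 0%E) ->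
  (forall i, 'V_P[X i] = (s i ^+ 2)%:E) ->
  is_cov_matrix P (fun t => W *m \col_i X i t) (W *m Sigma s *m W^T).
Proof.
move=> X2 X_uncor X_var i j.
have comb l : (fun t => (W *m \col_i X i t) l 0) =
    (fun t => \sum_i W l i * X i t).
  by apply/funext => t; rewrite mxE; apply: eq_bigr => a _; rewrite mxE.
rewrite !comb covariance_lincombl ?Lfun2_lincomb// mxE -sumEFin.
apply: eq_bigr => a _; rewrite covariance_lincombr//.
rewrite (bigD1 a)//= big1 => [|b ba]; last first.
  by rewrite X_uncor ?mule0// eq_sym.
rewrite adde0 -/(variance P (X a)) X_var /Sigma mul_mx_diag !mxE -!EFinM.
by congr (_%:E); ring.
Qed.

End Covariance.

(** * Coefficients of the least squares estimators *)

(** [f * g] sums to 0 and changes sign at most once, from negative to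
    positive, so non-increasing weights favour its negative part. Concretely, if
    [c] is the first index with [0 < f c], then [f i] and [v i - v c] never
    have the same strict sign, and subtracting [v c] from the weights leaves
    the sum unchanged. *)
Lemma sum_crossing_le0 {R : realDomainType} (n : nat) (f g v : 'I_n -> R) :
  (forall i j : 'I_n, (i <= j)%N -> f i <= f j) ->
  (forall i, 0 <= g i) ->
  (forall i j : 'I_n, (i <= j)%N -> v j <= v i) ->
  (forall i, 0 <= v i) ->
  \sum_i f i * g i = 0 ->
  \sum_i f i * g i * v i <= 0.
Proof.
move=> f_nd g_ge0 v_ni v_ge0 fg0.
have [[k fk_gt0]|f_le0] := pselect (exists k, 0 < f k); last first.
  apply: sumr_le0 => i _; rewrite mulr_le0_ge0// mulr_le0_ge0//.
  by rewrite leNgt; apply/negP => fi_gt0; apply: f_le0; exists i.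
case: (@arg_minnP _ k (fun i => 0 < f i) (fun i => i : nat) fk_gt0)
  => c fc_gt0 c_min.
have -> : \sum_i f i * g i * v i = \sum_i g i * (f i * (v i - v c)).
  transitivity (\sum_i (f i * g i * v i - v c * (f i * g i))).
    by rewrite big_split/= sumrN -mulr_sumr fg0 mulr0 subr0.
  by apply: eq_bigr => i _; ring.
apply: sumr_le0 => i _; rewrite mulr_ge0_le0//.
have [ci|ic] := leqP c i.
  by rewrite mulr_ge0_le0 ?subr_le0 ?v_ni// (le_trans (ltW fc_gt0))// f_nd.
rewrite mulr_le0_ge0 ?subr_ge0 ?v_ni ?(ltnW ic)//.
by rewrite leNgt; apply/negP => /c_min; rewrite leqNgt ic.
Qed.

Section Weight.
Context {R : fieldType}.
Implicit Types N a b p q y M : R.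

(** [(p, q) G^-1 (1, y)^T] for the Gram matrix [G] with rows [(N, a)] and
    [(a, b)], that is, [G = A^T A] when [N], [a], [b] are the number, the sum
    and the sum of squares of the points. *)
Definition weight N a b p q y :=
  (p * (b - a * y) + q * (N * y - a)) / (N * b - a ^+ 2).

(** Both sides are affine in [y] and agree at [y = M]; the coefficient of
    [M - y] is the determinant of the vectors [(p, q)] and [(1, M)], times that
    of the inverse Gram matrix. *)
Lemma weight_leverage N a b p q M y : N * b - a ^+ 2 != 0 ->
  weight N a b 1 M M * weight N a b p q y =
  weight N a b p q M * weight N a b 1 M y
  - (q - p * M) / (N * b - a ^+ 2) * (M - y).
Proof. by move=> D0; rewrite /weight; field. Qed.

(** The Sherman-Morrison formula for the Gram matrix enlarged by the point
    [M]. *)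
Lemma weight_update N a b p q M y : N * b - a ^+ 2 != 0 ->
  (N + 1) * (b + M ^+ 2) - (a + M) ^+ 2 != 0 ->
  weight (N + 1) (a + M) (b + M ^+ 2) p q y =
  weight N a b p q y
  - weight N a b p q M / (1 + weight N a b 1 M M) * weight N a b 1 M y.
Proof.
move=> D0 D1.
have L0 : 1 + weight N a b 1 M M =
    ((N + 1) * (b + M ^+ 2) - (a + M) ^+ 2) / (N * b - a ^+ 2).
  by rewrite /weight; field.
by rewrite L0 /weight; field; rewrite D0.
Qed.

(** Least squares recovers a straight line exactly from exact data: this is
    the identity [(A^T A)^-1 A^T A = 1]. *)
Lemma sum_weight_affine m (x : 'I_m -> R) p q c e :
  let N := m%:R in let a := \sum_i x i in let b := \sum_i x i ^+ 2 in
  N * b - a ^+ 2 != 0 ->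
  \sum_i weight N a b p q (x i) * (c + e * x i) = p * c + q * e.
Proof.
move=> N a b D0.
pose D := N * b - a ^+ 2.
transitivity (\sum_i ((p * b - q * a) * c / D
    + ((p * b - q * a) * e + (q * N - p * a) * c) / D * x i
    + (q * N - p * a) * e / D * x i ^+ 2)).
  by apply: eq_bigr => i _; rewrite /weight -/D; field.
rewrite !big_split/= -!mulr_sumr -/a -/b sumr_const card_ord.
rewrite -[_ *+ m]mulr_natl -/N /D.
by field.
Qed.

End Weight.

Section Moments.
Context {R : realFieldType}.

(** [m] times this quantity is the sum of the [(m x_i - \sum_j x_j) ^+ 2],
    which vanishes only if all the [x_i] are equal. *)
Lemma disc_gt0 m (x : 'I_m -> R) (i j : 'I_m) : x i != x j ->
  0 < m%:R * (\sum_i x i ^+ 2) - (\sum_i x i) ^+ 2.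
Proof.
pose N : R := m%:R; pose a := \sum_i x i; pose b := \sum_i x i ^+ 2.
rewrite -/N -/a -/b => xij.
have N_gt0 : 0 < N by rewrite ltr0n (leq_trans _ (ltn_ord i)).
have ND : N * (N * b - a ^+ 2) = \sum_i (N * x i - a) ^+ 2.
  transitivity (\sum_i (N ^+ 2 * x i ^+ 2 + (- (2 * N * a)) * x i + a ^+ 2)).
    rewrite !big_split/= -!mulr_sumr -/a -/b sumr_const card_ord.
    rewrite -[_ *+ m]mulr_natl -/N.
    by ring.
  by apply: eq_bigr => k _; ring.
rewrite -(pmulr_rgt0 _ N_gt0) ND lt_neqAle sumr_ge0 ?andbT => [|k _];
  last exact: sqr_ge0.
apply: contra xij; rewrite eq_sym psumr_eq0 => [|k _]; last exact: sqr_ge0.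
move=> /allP x0.
have xE k : N * x k = a.
  have /(_ (mem_index_enum k)) := x0 k.
  by rewrite /= sqrf_eq0 subr_eq0 => /eqP.
by apply/eqP/(mulfI (lt0r_neq0 N_gt0)); rewrite !xE.
Qed.

(** The comparison of the two variances, for any combination
    [p * beta1 + q * beta2] that satisfies the last hypothesis. That hypothesis
    makes the coefficient of [l y * (M - y)] in the variance gain nonpositive,
    and the sum of these terms, weighted by the variances, is itself
    nonpositive. *)
Lemma weight_variance_le m (x v : 'I_m -> R) (M vM p q : R) :
  let N := m%:R in let a := \sum_i x i in let b := \sum_i x i ^+ 2 in
  let w0 := weight N a b p q in
  let w1 := weight (N + 1) (a + M) (b + M ^+ 2) p q in
  (1 < m)%N ->
  (forall i j : 'I_m, (i < j)%N -> x i < x j) ->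
  (forall i, x i < M) ->
  (forall i j : 'I_m, (i <= j)%N -> v j <= v i) ->
  (forall i, vM <= v i) -> 0 <= vM ->
  0 <= (q - p * M) * w0 M ->
  \sum_i w1 (x i) ^+ 2 * v i + w1 M ^+ 2 * vM <= \sum_i w0 (x i) ^+ 2 * v i.
Proof.
move=> N a b w0 w1 m1 x_inc xM v_ni vMv vM_ge0 c_ge0.
pose i0 : 'I_m := Ordinal (ltnW m1); pose i1 : 'I_m := Ordinal m1.
pose D := N * b - a ^+ 2.
have D_gt0 : 0 < D.
  by apply: (@disc_gt0 _ _ i0 i1); rewrite lt_eqF ?x_inc.
have D_neq0 := lt0r_neq0 D_gt0.
pose l := weight N a b 1 M; pose L := l M.
have sumsq : \sum_i (M - x i) ^+ 2 = b - a * M + M * (N * M - a).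
  transitivity (\sum_i (M ^+ 2 + (- (2 * M)) * x i + x i ^+ 2)).
    by apply: eq_bigr => i _; ring.
  rewrite !big_split/= -!mulr_sumr -/a -/b sumr_const card_ord.
  rewrite -[_ *+ m]mulr_natl -/N.
  by ring.
have L_gt0 : 0 < L.
  rewrite /L /l /weight mul1r divr_gt0// -sumsq (bigD1 i0)//=.
  rewrite ltr_pwDl ?exprn_gt0 ?subr_gt0// sumr_ge0// => i _; exact: sqr_ge0.
have L1_gt0 : 0 < 1 + L by rewrite addr_gt0.
have D1_neq0 : (N + 1) * (b + M ^+ 2) - (a + M) ^+ 2 != 0.
  have -> : (N + 1) * (b + M ^+ 2) - (a + M) ^+ 2 = (1 + L) * D.
    by rewrite /L /l /weight /D; field.
  by rewrite mulf_neq0// lt0r_neq0.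
pose k := (1 + L)^-1.
have k_gt0 : 0 < k by rewrite invr_gt0.
have w1E y : w1 y = w0 y - k * w0 M * l y.
  by rewrite /w1 weight_update// -/l -/L -/w0 /k; field; exact: lt0r_neq0.
have slope_ge0 : 0 <= N * M - a.
  have -> : N * M - a = \sum_i (M - x i).
    by rewrite sumrB sumr_const card_ord -[_ *+ m]mulr_natl.
  by rewrite sumr_ge0// => i _; rewrite subr_ge0 ltW.
have l_nd (i j : 'I_m) : (i <= j)%N -> l (x i) <= l (x j).
  rewrite leq_eqVlt => /predU1P[/val_inj->//|/x_inc xij].
  rewrite -subr_ge0.
  have -> : l (x j) - l (x i) = (N * M - a) * (x j - x i) / D.
    by rewrite /l /weight /D; field.
  apply: divr_ge0 (ltW D_gt0); apply: mulr_ge0 => //.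
  by rewrite subr_ge0 ltW.
have lMx0 : \sum_i l (x i) * (M - x i) = 0.
  under eq_bigr do rewrite -mulN1r.
  by rewrite sum_weight_affine//; ring.
have lMxv_le0 : \sum_i l (x i) * (M - x i) * v i <= 0.
  apply: sum_crossing_le0 => // i; first by rewrite subr_ge0 ltW.
  exact: le_trans vM_ge0 (vMv i).
(* [l] is itself affine, and so is reproduced by its own weights. *)
have suml2 : \sum_i l (x i) ^+ 2 = L.
  transitivity (\sum_i l (x i) * ((b - a * M) / D + (N * M - a) / D * x i)).
    by apply: eq_bigr => i _; rewrite /l /weight -/D; field.
  by rewrite sum_weight_affine// /L /l /weight -/D; field.
have suml2v : vM * L <= \sum_i l (x i) ^+ 2 * v i.
  rewrite -suml2 mulr_sumr ler_sum// => i _.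
  by rewrite mulrC ler_wpM2l ?sqr_ge0.
(* The update formula makes [w0 - w1] a multiple of [l]; eliminating [w0]
   with [weight_leverage] and [k * L = 1 - k] leaves only [l] and [M - x]. *)
have gainE : L * (\sum_i w0 (x i) ^+ 2 * v i - \sum_i w1 (x i) ^+ 2 * v i) =
   k * (1 + k) * w0 M ^+ 2 * (\sum_i l (x i) ^+ 2 * v i)
   - 2 * k * ((q - p * M) * w0 M) / D * \sum_i l (x i) * (M - x i) * v i.
  rewrite -sumrB !mulr_sumr -sumrB; apply: eq_bigr => i _.
  have Lw := @weight_leverage _ N a b p q M (x i) D_neq0.
  rewrite -/l -/L -/w0 -/D in Lw.
  have kL : k * L = 1 - k by rewrite /k; field; exact: lt0r_neq0.
  rewrite w1E.
  transitivity (k * w0 M * l (x i)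
      * (2 * (L * w0 (x i)) - k * L * w0 M * l (x i)) * v i).
    by ring.
  by rewrite Lw kL; field.
have w1M : w1 M = k * w0 M.
  by rewrite w1E -/L /k; field; exact: lt0r_neq0.
rewrite addrC -lerBrDr -(ler_pM2l L_gt0) gainE w1M.
set S := \sum_i l (x i) ^+ 2 * v i in suml2v *.
apply: (@le_trans _ _ (k * (1 + k) * w0 M ^+ 2 * S)); last first.
  rewrite lerDl oppr_ge0 mulr_ge0_le0// divr_ge0 ?(ltW D_gt0)//.
  by rewrite (mulr_ge0 (mulr_ge0 (ler0n _ 2) (ltW k_gt0)) c_ge0).
apply: (@le_trans _ _ (k * (1 + k) * w0 M ^+ 2 * (vM * L))); last first.
  rewrite ler_wpM2l// mulr_ge0 ?sqr_ge0// mulr_ge0 ?(ltW k_gt0)//.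
  by rewrite addr_ge0 ?(ltW k_gt0).
rewrite -subr_ge0.
(* The excess of the gain over the cost of the new observation. *)
have -> : k * (1 + k) * w0 M ^+ 2 * (vM * L) - L * ((k * w0 M) ^+ 2 * vM) =
  k * w0 M ^+ 2 * vM * L by ring.
apply: mulr_ge0 (ltW L_gt0).
exact: mulr_ge0 (mulr_ge0 (ltW k_gt0) (sqr_ge0 _)) vM_ge0.
Qed.

Lemma slope_weight_ge0 m (x : 'I_m -> R) (M : R) :
  let N := m%:R in let a := \sum_i x i in let b := \sum_i x i ^+ 2 in
  0 < N * b - a ^+ 2 -> (forall i, x i <= M) ->
  0 <= (1 - 0 * M) * weight N a b 0 1 M.
Proof.
move=> N a b D_gt0 xM.
rewrite /weight !mul0r subr0 !mul1r add0r divr_ge0 ?(ltW D_gt0)//.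
have -> : N * M - a = \sum_i (M - x i).
  by rewrite sumrB sumr_const card_ord -[_ *+ m]mulr_natl.
by apply: sumr_ge0 => i _; rewrite subr_ge0.
Qed.

(** The intercept is the predicted value at 0, so new data to the right of
    nonnegative points enter it with a nonpositive coefficient: up to a positive
    factor, that coefficient is minus the sum of the [x_i (M - x_i)]. *)
Lemma intercept_weight_ge0 m (x : 'I_m -> R) (M : R) :
  let N := m%:R in let a := \sum_i x i in let b := \sum_i x i ^+ 2 in
  0 < N * b - a ^+ 2 -> 0 <= M -> (forall i, 0 <= x i <= M) ->
  0 <= (0 - 1 * M) * weight N a b 1 0 M.
Proof.
move=> N a b D_gt0 M_ge0 xM.
rewrite /weight mul0r addr0 !mul1r sub0r mulNr -mulrN -mulNr opprB.
apply: mulr_ge0 => //; apply: divr_ge0 (ltW D_gt0).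
rewrite mulrC mulr_sumr -sumrB; apply: sumr_ge0 => i _.
have /andP[x_ge0 x_le] := xM i.
have -> : M * x i - x i ^+ 2 = x i * (M - x i) by ring.
by rewrite mulr_ge0 ?subr_ge0.
Qed.

End Moments.

(** * The covariance matrix of the estimators *)

Section Design.
Context {R : realType}.

Lemma ols_covE m (A : 'M[R]_(m, 2)) (S : 'M[R]_m) :
  ols_cov A S =
  invmx (A^T *m A) *m A^T *m S *m (invmx (A^T *m A) *m A^T)^T.
Proof.
by rewrite trmx_mul trmxK trmx_inv trmx_mul trmxK /ols_cov !mulmxA.
Qed.

Lemma ols_cov_diag m (x s : 'I_m -> R) (j : 'I_2) :
  let N := m%:R in let a := \sum_i x i in let b := \sum_i x i ^+ 2 in
  N * b - a ^+ 2 != 0 ->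
  ols_cov (design x) (Sigma s) j j =
  \sum_k weight N a b (j == 0)%:R (j == 1)%:R (x k) ^+ 2 * s k ^+ 2.
Proof.
move=> N a b D0.
pose D := N * b - a ^+ 2.
pose G : 'M[R]_2 := \matrix_(i, j)
  if i == 0 then (if j == 0 then b / D else - a / D)
  else (if j == 0 then - a / D else N / D).
have gram (u v : 'I_2) : ((design x)^T *m design x) u v =
    if u == 0 then (if v == 0 then N else a)
    else (if v == 0 then a else b).
  rewrite mxE; under eq_bigr do rewrite !mxE.
  case: (u == 0); case: (v == 0).
  - by rewrite mulr1 sumr_const card_ord.
  - by apply: eq_bigr => i _; rewrite mul1r.
  - by apply: eq_bigr => i _; rewrite mulr1.
  - by apply: eq_bigr => i _; rewrite expr2.
have GK : G *m ((design x)^T *m design x) = 1%:M.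
  apply/matrixP => u v; rewrite mxE !big_ord_recl big_ord0 !gram !mxE /=.
  by case: u => -[|[|//]] ?; case: v => -[|[|//]] ? /=; rewrite /D; field.
have GE : invmx ((design x)^T *m design x) = G.
  have [_ U] := mulmx1_unit GK.
  by rewrite -[LHS]mul1mx -GK mulmxK.
rewrite ols_covE GE mxE; apply: eq_bigr => k _.
have WE : (G *m (design x)^T) j k = weight N a b (j == 0)%:R (j == 1)%:R (x k).
  rewrite mxE !big_ord_recl big_ord0 !mxE /=.
  by case: j => -[|[|//]] ? /=; rewrite /weight -/D; field.
by rewrite [(G *m _)^T _ _]mxE mul_mx_diag mxE WE mxE; ring.
Qed.

End Design.

(** * Variance reduction *)

Theorem theorem3 (R : realType) (d : measure_display) (T : measurableType d)
    (P : probability T R) (n : nat) (n_gt1 : (1 < n)%N)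
    (beta1 beta2 : R) (h sigma : 'I_n.+1 -> R)
    (Y eps : 'I_n.+1 -> {RV P >-> R})
    (model : forall i t, Y i t = beta1 + beta2 * h i + eps i t)
    (Y_L2 : forall i, (Y i : T -> R) \in Lfun P 2%:E)
    (eps_mean : forall i, ('E_P[eps i] = 0)%E)
    (Y_uncorrelated : forall i j, i != j -> (covariance P (Y i) (Y j) = 0)%E)
    (Y_variance : forall i, ('V_P[Y i] = (sigma i ^+ 2)%R%:E)%E)
    (sigma_noninc : forall i j : 'I_n.+1,
       (i <= j)%N -> sigma j ^+ 2 <= sigma i ^+ 2)
    (h_ge0 : 0 <= h ord0)
    (h_inc : forall i j : 'I_n.+1, (i < j)%N -> h i < h j) :
  [/\ is_cov_matrix P (beta_hat0 h Y) (V00 h sigma),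
      is_cov_matrix P (beta_hat1 h Y) (V11 h sigma)
    & forall i : 'I_2, V11 h sigma i i <= V00 h sigma i i].
Proof.
split.
- rewrite /V00 ols_covE.
  apply: is_cov_matrix_linear => // i j ij; apply: Y_uncorrelated.
  by apply: contra ij => /eqP/(congr1 val)/= /val_inj ->.
- by rewrite /V11 ols_covE; apply: is_cov_matrix_linear.
move=> j.
pose x := h \o @first_obs n; pose M := h ord_max.
have A0E : A0 h = design x by apply/matrixP => i k; rewrite !mxE.
have x_inc (i k : 'I_n) : (i < k)%N -> x i < x k by move=> ik; exact: h_inc.
have xM i : x i < M by apply: h_inc; rewrite /= ltn_ord.
have h_nn i : 0 <= h i.
  have [->//|i0] := eqVneq i ord0.
  by apply: le_trans h_ge0 (ltW (h_inc _ _ _)); rewrite lt0n.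
have D0 : 0 < n%:R * (\sum_i x i ^+ 2) - (\sum_i x i) ^+ 2.
  apply: (@disc_gt0 _ _ _ (Ordinal (ltnW n_gt1)) (Ordinal n_gt1)).
  by rewrite lt_eqF// x_inc.
have D1 : 0 < n.+1%:R * (\sum_i h i ^+ 2) - (\sum_i h i) ^+ 2.
  by apply: (@disc_gt0 _ _ _ ord0 ord_max); rewrite lt_eqF// h_inc// ltnW.
rewrite /V11 /V00 A0E !ols_cov_diag ?lt0r_neq0//.
rewrite !big_ord_recr/= -natr1.
apply: weight_variance_le => //.
- by move=> i k ik; exact: sigma_noninc.
- by move=> i; apply: sigma_noninc; exact: leq_ord.
- exact: sqr_ge0.
case: j => -[|[|//]] ? /=.
- by apply: intercept_weight_ge0 => // i; rewrite (ltW (xM i)) andbT;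
    exact: h_nn.
- by apply: slope_weight_ge0 => // i; exact: ltW (xM i).
Qed.
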